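(* For $n<\omega$ let $\mathcal{A}_n=\{X\in P(n)\mid |X|=\frac{n}{2}\}$ (so $\mathcal{A}_n=\emptyset$ for odd $n$), and let $\vec{\mathcal{A}}=\langle\mathcal{A}_n\mid n<\omega\rangle$. Then $|\mathcal{A}_n|=\binom{n}{n/2}$ for every even $n$, and $\mathbb{P}_0(\mathrm{G}(\vec{\mathcal{A}}))=1$.
   Context: Each $n<\omega$ is identified with $\{0,\dots,n-1\}$, and $P(\omega)$ is identified with $2^\omega$ via indicator functions. $\mathbb{P}_0$ is the standard Borel probability measure on $2^\omega$, determined by $\mathbb{P}_0(C_t)=2^{-|t|}$ for $t\in 2^{<\omega}$, where $C_t$ is the set of $f\in 2^\omega$ extending $t$ (the fair coin-flipping measure). For a sequence $\vec{\mathcal{A}}=\langle\mathcal{A}_n\mid n<\omega\rangle$ with $\mathcal{A}_n\subseteq P(n)$, the set of guessed reals is $\mathrm{G}(\vec{\mathcal{A}})=\{X\in P(\omega)\mid X\cap n\in\mathcal{A}_n\text{ for infinitely many }n\}$. *)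

(* Defs.v *)
From HB Require Import structures.
From mathcomp Require Import all_boot all_order all_algebra.
From mathcomp Require Import all_classical all_reals all_analysis.

Set Implicit Arguments.
Unset Strict Implicit.
Unset Printing Implicit Defensive.

Import Order.TTheory GRing.Theory Num.Theory.
Import numFieldNormedType.Exports.

Local Open Scope classical_set_scope.
Local Open Scope ring_scope.

(* 2^omega, i.e. P(omega) via indicator functions, with its Borel sets. *)
Definition borel_cantor := g_sigma_algebraType (@open cantor_space).

(* C_t, the set of all f extending the finite sequence t. *)
Definition cylinder (t : seq bool) : set borel_cantor :=
  [set f | forall i, (i < size t)%N -> f i = nth false t i].

(* X :&: n, as a subset of n = {0, ..., n-1}. *)
Definition trace (X : borel_cantor) (n : nat) : {set 'I_n} :=
  [set i : 'I_n | X i]%SET.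

Definition guessed_reals (A : forall n, {set {set 'I_n}}) : set borel_cantor :=
  [set X | infinite_set [set n | trace X n \in A n]].

(* |X| = n/2 is an equation between rationals: no X satisfies it for odd n. *)
Definition half_sets (n : nat) : {set {set 'I_n}} :=
  [set X : {set 'I_n} | #|X|%:R == n%:R / 2 :> rat]%SET.

Lemma half_setsE n (X : {set 'I_n}) : (X \in half_sets n) = (#|X|.*2 == n).
Proof.
by rewrite inE eq_sym -subr_eq0 -(mulrI_eq0 _ (@mulfI rat 2 _)) // mulrBr
  mulrCA divff // mulr1 subr_eq0 -natrM eqr_nat eq_sym mul2n.
Qed.

Lemma half_sets_odd n : odd n -> half_sets n = finset.set0.
Proof.
move=> on; apply/setP => X; rewrite half_setsE inE; apply/eqP => Xn.
by rewrite -Xn odd_double in on.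
Qed.

Lemma cylinderE (f : borel_cantor) n g :
  cylinder (mkseq f n) g <-> forall i, (i < n)%N -> g i = f i.
Proof.
by rewrite /cylinder /= size_mkseq; split=> h i ni; rewrite h // nth_mkseq.
Qed.

Lemma cylinder_rcons t b (f : borel_cantor) :
  cylinder (rcons t b) f <-> cylinder t f /\ f (size t) = b.
Proof.
rewrite /cylinder /= size_rcons; split=> [h|[h1 h2] i].
  split=> [i it|]; first by rewrite h ?nth_rcons ?it // ltnW.
  by rewrite h // nth_rcons ltnn eqxx.
rewrite ltnS leq_eqVlt nth_rcons => /orP[/eqP->|it]; last by rewrite it h1.
by rewrite ltnn eqxx.
Qed.

Lemma open_coord i b : open [set f : cantor_space | f i = b].
Proof.
have /continuousP : continuous (fun f : cantor_space => f i).
  exact: (@proj_continuous nat (fun=> bool) i).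
by move=> /(_ [set b]); apply; exact: discrete_open.
Qed.

Lemma measurable_coord i b : measurable [set f : borel_cantor | f i = b].
Proof. by apply: sub_sigma_algebra; exact: open_coord. Qed.

Lemma measurable_cylinder t : measurable (cylinder t).
Proof.
rewrite (_ : cylinder t = \bigcap_(i in [set i | (i < size t)%N])
    [set f : borel_cantor | f i = nth false t i]) //.
by apply: bigcap_measurableType => i _; exact: measurable_coord.
Qed.

Lemma nbhs_cylinder (f : cantor_space) (U : set cantor_space) :
  nbhs f U -> exists n, cylinder (mkseq f n) `<=` U.
Proof.
pose F : set_system cantor_space :=
  filter_from setT (fun n => cylinder (mkseq f n)).
have FF : Filter F.
  apply: filter_from_filter; first by exists 0%N.
  move=> i j _ _; exists (maxn i j) => // g /cylinderE h.
  by split; apply/cylinderE => k kl; apply: h; rewrite leq_max kl ?orbT.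
have : {ptws, F --> f}.
  apply/pointwise_cvgP => i A /nbhs_singleton Afi.
  by exists i.+1 => // g /cylinderE /(_ i (ltnSn _)) /= ->.
by move=> /(_ U) h /h [n _ nU]; exists n.
Qed.

Lemma open_bigcup_cylinder (U : set cantor_space) : open U ->
  U = \bigcup_(t in [set t | cylinder t `<=` U]) cylinder t.
Proof.
move=> oU; apply/seteqP; split=> [f Uf|f [t tU tf]]; last exact: tU.
have [n nU] := nbhs_cylinder (open_nbhs_nbhs (conj oU Uf)).
by exists (mkseq f n) => //; apply/cylinderE.
Qed.

Lemma infinite_natP (A : set nat) :
  infinite_set A <-> forall m, exists2 n, (m <= n)%N & A n.
Proof.
split=> [infA m|Aub /finite_seqP[F AF]].
  apply: contrapT => noA; apply: infA.
  apply: (@sub_finite_set _ _ `I_m) => [n An|]; last exact: finite_II.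
  by rewrite /= ltnNge; apply/negP => mn; apply: noA; exists n.
have [n nF] := Aub (\max_(k <- F) k).+1.
rewrite AF /= => Fn; move: nF; apply/negP; rewrite -ltnNge ltnS.
by apply: (@leq_bigmax_seq _ _ xpredT id).
Qed.

Lemma measurable_trace n (S : {set {set 'I_n}}) :
  measurable [set X : borel_cantor | trace X n \in S].
Proof.
have -> : [set X : borel_cantor | trace X n \in S] =
    \bigcup_(Y in [set Y | Y \in S]) \bigcap_(i in [set: 'I_n])
      [set X : borel_cantor | X i = (i \in Y)].
  apply/seteqP; split=> [X XS|X [Y YS XY]] /=.
    by exists (trace X n) => // i _; rewrite /= inE.
  suff -> : trace X n = Y by [].
  by apply/setP => i; rewrite inE; exact: XY.
apply: fin_bigcup_measurable; first exact: finite_finset.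
move=> Y _; apply: fin_bigcap_measurable; first exact: finite_finset.
by move=> i _; exact: measurable_coord.
Qed.

Lemma measurable_guessed_reals A : measurable (guessed_reals A).
Proof.
have -> : guessed_reals A = \bigcap_m \bigcup_(n in [set n | (m <= n)%N])
    [set X | trace X n \in A n].
  apply/seteqP; split=> X /=.
    by move=> /infinite_natP XA m _; have [n mn Xn] := XA m; exists n.
  by move=> XA; apply/infinite_natP => m; have [n mn Xn] := XA m I; exists n.
apply: bigcapT_measurable => m; apply: bigcup_measurable => n _.
exact: measurable_trace.
Qed.

Section fair_coin.
Context {R : realType}.

Definition binary_digits (x : measurableTypeR R) : borel_cantor :=
  fun i => odd (Num.truncn ((x : R) * 2 ^+ i.+1)).

Lemma measurable_truncn_eq (c : R) k : 0 < c ->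
  measurable [set x : R | Num.truncn (x * c) = k].
Proof.
move=> c0; have mle n : measurable [set x : R | (Num.truncn (x * c) <= n)%N].
  rewrite (_ : mkset _ = `]-oo, (n.+1%:R / c)[%classic).
    exact: measurable_itv.
  by apply/seteqP; split=> x /=; rewrite in_itv /= truncn_le_nat ltr_pdivlMr.
case: k => [|k].
  rewrite (_ : mkset _ = [set x | (Num.truncn (x * c) <= 0)%N]) //.
  by apply/seteqP; split=> x /=; rewrite leqn0 => /eqP.
rewrite (_ : mkset _ = [set x | (Num.truncn (x * c) <= k.+1)%N] `\`
    [set x | (Num.truncn (x * c) <= k)%N]); first exact: measurableD.
apply/seteqP; split=> x /=; first by move=> ->; rewrite ltnn.
by move=> [h1 /negP]; rewrite -ltnNge => h2; apply/eqP; rewrite eqn_leq h1.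
Qed.

Lemma measurable_preimage_cylinder t :
  measurable (binary_digits @^-1` cylinder t).
Proof.
rewrite (_ : _ @^-1` _ = \bigcap_(i in [set i | (i < size t)%N])
    \bigcup_(k in [set k | odd k = nth false t i])
      [set x : R | Num.truncn (x * 2 ^+ i.+1) = k]).
  apply: bigcap_measurableType => i _; apply: bigcup_measurable => k _.
  by apply: measurable_truncn_eq; rewrite exprn_gt0.
apply/seteqP; split=> [x xt i it|x xt i it].
  by exists (Num.truncn (x * 2 ^+ i.+1)) => //=; exact: xt.
by have [k /= <- <-] := xt i it.
Qed.

Lemma measurable_binary_digits : measurable_fun setT binary_digits.
Proof.
apply: (@measurability _ _ _ borel_cantor _ _ (@open cantor_space)) => // _ [U oU <-].
rewrite setTI (open_bigcup_cylinder oU) preimage_bigcup bigcup_mkcond.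
apply: countable_bigcupT_measurable => // t; case: ifP => // _.
exact: measurable_preimage_cylinder.
Qed.

HB.instance Definition _ :=
  isMeasurableFun.Build _ _ (measurableTypeR R) borel_cantor
  binary_digits measurable_binary_digits.

(* The fair coin-flipping measure, as the law of the sequence of binary digits of a uniform
   real number; see fair_coin_cylinder for the characteristic property. *)
Definition fair_coin : probability borel_cantor R :=
  distribution (uniform_prob (@ltr01 R)) binary_digits.

Let value (t : seq bool) := foldl (fun n (b : bool) => (n.*2 + b)%N) 0%N t.

Let value_lt t : (value t < 2 ^ size t)%N.
Proof.
elim/last_ind: t => // t b IH; rewrite /value foldl_rcons size_rcons expnS.
rewrite mul2n -/(value t); case: b; rewrite ?addn1 ?addn0 ?ltn_double //.
by rewrite -doubleS leq_double.
Qed.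

Let truncn_half (y : R) : 0 <= y -> Num.truncn y = (Num.truncn (y * 2))./2.
Proof.
move=> y0; apply: truncn_def.
have y20 : 0 <= y * 2 by rewrite mulr_ge0.
have /andP[h1 h2] := truncn_itv y20; set n := Num.truncn _ in h1 h2 *.
rewrite -(ler_pM2r (@ltr0Sn R 1)) -(ltr_pM2r (@ltr0Sn R 1)) -!natrM !muln2.
apply/andP; split.
  by apply: le_trans h1; rewrite ler_nat -{2}(odd_double_half n) leq_addl.
apply: lt_le_trans h2 _; rewrite ler_nat doubleS -{1}(odd_double_half n).
by case: odd.
Qed.

Let cylinder_binary_digits t (x : R) : 0 <= x < 1 ->
  cylinder t (binary_digits x) <-> Num.truncn (x * 2 ^+ size t) = value t.
Proof.
move=> /andP[x0 x1]; elim/last_ind: t => [|t b IH].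
  rewrite expr0 mulr1; split=> // _.
  by apply: truncn_def; rewrite x0.
rewrite cylinder_rcons IH size_rcons /value foldl_rcons -/(value t).
rewrite (truncn_half (mulr_ge0 x0 (exprn_ge0 _ (ler0n _ 2)))) -mulrA -exprSr.
rewrite /binary_digits; set n := Num.truncn _; split=> [[<- <-]|->].
  by rewrite addnC odd_double_half.
by rewrite addnC half_bit_double oddD odd_double addbF oddb.
Qed.

Let uniform01 (a b : R) : 0 <= a -> a <= b -> b <= 1 ->
  uniform_prob (@ltr01 R) `[a, b[ = (b - a)%:E.
Proof.
move=> a0 ab b1; rewrite /uniform_prob.
rewrite (eq_integral (fun=> 1%:E)) => [|x]; last first.
  rewrite inE /= in_itv /= => /andP[ax xb]; rewrite /uniform_pdf.
  by rewrite (le_trans a0 ax) (ltW (lt_le_trans xb b1)) subr0 invr1.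
rewrite integral_cst //= mul1e lebesgue_measure_itv /= lte_fin.
by move: ab; rewrite le_eqVlt => /predU1P[->|->]; rewrite ?ltxx ?subrr.
Qed.

Lemma fair_coin_cylinder t : fair_coin (cylinder t) = (2 ^- size t)%:E.
Proof.
pose P : probability (measurableTypeR R) R := uniform_prob (@ltr01 R).
pose U := binary_digits @^-1` cylinder t.
rewrite -[LHS]/(P U).
have mU : measurable U by exact: measurable_preimage_cylinder.
have mI : measurable (`[0, 1[%classic : set R) by exact: measurable_itv.
have PI : P (~` `[0, 1[) = 0%E.
  by rewrite (probability_setC P mI) /P /= uniform01 // subr0 subee.
have PU : P (U `\` `[0, 1[) = 0%E.
  apply: subset_measure0 PI => //; first exact: measurableD.
  exact: measurableC.
have -> : P U = P (U `&` `[0, 1[).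
  by rewrite (measureDI P mU mI) [X in (X + _)%E](_ : _ = 0%E) ?add0e //; exact: PU.
have n0 : 0 < 2 ^+ size t :> R by rewrite exprn_gt0.
have -> : U `&` `[0, 1[ =
    `[(value t)%:R / 2 ^+ size t, (value t).+1%:R / 2 ^+ size t[%classic.
  apply/seteqP; split=> x /=; rewrite !in_itv /=.
    move=> [Ux x01]; move: (Ux) => /(cylinder_binary_digits _ x01) xt.
    rewrite ler_pdivrMr // ltr_pdivlMr // -xt truncn_itv // mulr_ge0 ?exprn_ge0 //.
    by case/andP: x01.
  rewrite ler_pdivrMr // ltr_pdivlMr // => xt.
  have x0 : 0 <= x.
    by rewrite -(pmulr_lge0 _ n0) (le_trans _ (proj1 (andP xt))).
  have x1 : x < 1.
    rewrite -(ltr_pM2r n0) mul1r (lt_le_trans (proj2 (andP xt))) //.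
    by rewrite -natrX ler_nat value_lt.
  have x01 : 0 <= x < 1 by rewrite x0.
  by split=> //; apply/(cylinder_binary_digits _ x01); exact: truncn_def.
rewrite /P /= uniform01.
- by rewrite -mulrBl -natrB // subSnn mul1r.
- by rewrite divr_ge0 // ltW.
- by rewrite ler_pM2r ?invr_gt0 // ler_nat.
- by rewrite ler_pdivrMr // mul1r -natrX ler_nat value_lt.
Qed.

End fair_coin.

(* Main.v *)
Require Import Defs.
From mathcomp Require Import all_boot all_order all_algebra.
From mathcomp Require Import all_classical all_reals all_analysis.
From mathcomp Require Import zify lra.

Set Implicit Arguments.
Unset Strict Implicit.
Unset Printing Implicit Defensive.

Import Order.TTheory GRing.Theory Num.Theory.
Import numFieldNormedType.Exports.

Local Open Scope ring_scope.

(** The cardinality is the count of the n/2-element subsets of an n-element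
set. The probabilistic part is the recurrence of the simple random walk on the
integers: reading the digits of X as steps +1 and -1, the trace of X on n has
n/2 elements exactly when the walk is at 0 at time n ([half_sets_trace]), so X
is guessed if and only if its walk visits 0 infinitely often.

Only the distance k from the walk to 0 matters. As long as it is positive, it
goes to k - 1 or to k + 1 with probability 1/2 each, so the probability that
the walk avoids 0 for N more steps is the number [survival N k] given by the
corresponding recursion. For fixed k it decreases with N, and its limit h(k)
satisfies h(0) = 0 and h(k + 1) = (h(k) + h(k + 2)) / 2. Such an h is linear,
h(k) = k h(1), and since it is bounded by 1 it vanishes
([bounded_harmonic_eq0], [survival_cvg0]). No estimate of central binomial
coefficients is involved.

To transfer this to the measure, fix a finite sequence t. The probability of
extending t and avoiding balance for N more steps is at most
2^-|t| survival N (imbalance t): this goes by induction on N, splitting the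
cylinder of t into those of its two one-digit extensions
([fair_coin_unbalanced_stretch]). Letting N grow, almost no extension of t is
unbalanced at every time from |t| on. The reals that are not guessed are a
union of such null sets over the countably many t
([not_guessed_never_balanced]). *)

Section survival.
Context {R : realType}.
Implicit Types N k : nat.

(** The probability that a simple random walk starting at distance k from 0 is
not at 0 at any of the times 0, ..., N. *)
Fixpoint survival N k : R :=
  match k, N with
  | 0%N, _ => 0
  | _.+1, 0%N => 1
  | k'.+1, N'.+1 => (survival N' k' + survival N' k'.+2) / 2
  end.

Lemma survival0 N : survival N 0 = 0.
Proof. by case: N. Qed.

Lemma survival_ge0 N k : 0 <= survival N k.
Proof.
by elim: N k => [|N IH] [|k] //=; rewrite divr_ge0 // addr_ge0.
Qed.

Lemma survival_le1 N k : survival N k <= 1.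
Proof.
elim: N k => [|N IH] [|k] //=.
by have := IH k; have := IH k.+2; lra.
Qed.

(** Follows by induction from the comparison of N = 1 with N = 0, because the
recursion is monotone. *)
Lemma survivalS_le N k : survival N.+1 k <= survival N k.
Proof.
elim: N k => [|N IH] [|k] //; first exact: survival_le1.
(* Unfold one step on both sides, but not the inner survival N.+1. *)
change ((survival N.+1 k + survival N.+1 k.+2) / 2 <=
        (survival N k + survival N k.+2) / 2).
by have := IH k; have := IH k.+2; lra.
Qed.

Lemma harmonic_linear (h : nat -> R) : h 0%N = 0 ->
  (forall k, h k.+1 = (h k + h k.+2) / 2) -> forall k, h k = h 1%N *+ k.
Proof.
move=> h0 hS k; suff [] : h k = h 1%N *+ k /\ h k.+1 = h 1%N *+ k.+1 by [].
elim: k => [|k [IH1 IH2]]; first by rewrite h0.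
split=> //; have := hS k; rewrite IH1 IH2 !(mulrS (h 1%N)).
by move: (h 1%N *+ k) => x; lra.
Qed.

(** A discrete Liouville property on the half-line: a nonzero slope h(1) would
make h exceed 1 beyond the index 1 / h(1). *)
Lemma bounded_harmonic_eq0 (h : nat -> R) : h 0%N = 0 ->
  (forall k, h k.+1 = (h k + h k.+2) / 2) ->
  (forall k, 0 <= h k <= 1) -> forall k, h k = 0.
Proof.
move=> h0 hS h01 k; have lin := harmonic_linear h0 hS.
suff h1 : h 1%N = 0 by rewrite lin h1 mul0rn.
apply/eqP; rewrite eq_le (proj1 (andP (h01 1%N))) andbT leNgt; apply/negP => h1.
have := truncnS_gt (h 1%N)^-1; set n := Num.truncn _.
rewrite -(ltr_pM2l h1) mulfV ?gt_eqF // mulr_natr -lin ltNge.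
by case/andP: (h01 n.+1) => _ ->.
Qed.

Local Open Scope classical_set_scope.

(** The pointwise limit in N exists by monotonicity, and the recursion passes
to the limit as the equation of harmonic functions. *)
Lemma survival_cvg0 k : (fun N => survival N k) @ \oo --> (0 : R).
Proof.
pose h k := limn (fun N => survival N k).
have cvgh j : (fun N => survival N j) @ \oo --> h j.
  apply: nonincreasing_is_cvgn.
    by apply/nonincreasing_seqP => N; exact: survivalS_le.
  by exists 0 => _ [N _ <-]; exact: survival_ge0.
rewrite -(@bounded_harmonic_eq0 h _ _ _ k) //.
- by apply/cvg_lim => //; under eq_fun do rewrite survival0; exact: cvg_cst.
- move=> j; apply/cvg_lim => //; rewrite -cvg_shiftS /=.
  by apply: cvgMr_tmp; exact: cvgD.
- move=> j; apply/andP; split.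
    by apply: limr_ge; [exact: cvgP (cvgh j)|near=> N; exact: survival_ge0].
  by apply: limr_le; [exact: cvgP (cvgh j)|near=> N; exact: survival_le1].
Unshelve. all: by end_near. Qed.

End survival.

(** The distance to 0 of the walk after the steps t. *)
Definition imbalance (t : seq bool) : nat := `|count id t - count negb t|%N.

(** Away from balance, the minority digit b brings the walk closer to 0 and the
other digit takes it farther. Stating this for some b, rather than for the two
signs of the position, lets natural number distances stand for integer
positions. *)
Lemma imbalance_rcons t k : imbalance t = k.+1 -> exists b,
  imbalance (rcons t b) = k /\ imbalance (rcons t (~~ b)) = k.+2.
Proof.
rewrite /imbalance => tk; exists (count id t < count negb t)%N.
by rewrite -!cats1 !count_cat /=; case: ltnP => /=; lia.
Qed.

Lemma half_sets_trace (X : borel_cantor) n :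
  (trace X n \in half_sets n) = (imbalance (mkseq X n) == 0%N).
Proof.
rewrite half_setsE; have <- : count id (mkseq X n) = #|trace X n|.
  rewrite /trace cardsE cardE /enum_mem size_filter count_map -val_enum_ord count_map.
  by rewrite enumT; apply: eq_count.
have := count_predC id (mkseq X n); rewrite size_mkseq.
rewrite /imbalance (eq_count (a1 := predC id) (a2 := negb)) //; lia.
Qed.

Section measure.
Context {R : realType}.
Local Open Scope classical_set_scope.

Definition unbalanced_stretch (t : seq bool) N : set borel_cantor :=
  cylinder t `&` [set X | forall n, (size t <= n <= size t + N)%N ->
                          trace X n \notin half_sets n].

Lemma measurable_unbalanced_stretch t N : measurable (unbalanced_stretch t N).
Proof.
apply: measurableI; first exact: measurable_cylinder.
rewrite (_ : mkset _ = \bigcap_(n in [set n | (size t <= n <= size t + N)%N])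
    [set X | trace X n \in (~: half_sets n)%SET]).
  by apply: bigcap_measurableType => n _; exact: measurable_trace.
by apply/seteqP; split=> X XN n nN; have := XN n nN; rewrite /= finset.in_setC.
Qed.

Lemma cylinder_mkseq (t : seq bool) (X : borel_cantor) :
  cylinder t X -> mkseq X (size t) = t.
Proof.
move=> tX; apply: (@eq_from_nth _ false); rewrite size_mkseq // => i it.
by rewrite nth_mkseq // tX.
Qed.

(** The stretch includes the time |t| itself. *)
Lemma unbalanced_stretch_balanced t N :
  imbalance t = 0%N -> unbalanced_stretch t N = set0.
Proof.
move=> t0; rewrite -subset0 => X [tX /(_ (size t))].
by rewrite half_sets_trace cylinder_mkseq // t0 leqnn leq_addr => /(_ isT).
Qed.

(** The recursion of [survival] is that of these probabilities: the next digit
splits the event into two events of the same kind, whose cylinders have half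
the mass. Subadditivity is enough, since only an upper bound is wanted. *)
Lemma fair_coin_unbalanced_stretch t N :
  (@fair_coin R (unbalanced_stretch t N) <=
   (2 ^- size t * survival N (imbalance t))%:E)%E.
Proof.
elim: N t => [|N IH] t; case tk: (imbalance t) => [|k].
- by rewrite unbalanced_stretch_balanced // measure0 mulr0.
- rewrite mulr1 -fair_coin_cylinder; apply: le_measure; last by move=> X [].
    by rewrite inE; exact: measurable_unbalanced_stretch.
  by rewrite inE; exact: measurable_cylinder.
- by rewrite unbalanced_stretch_balanced // measure0 mulr0.
have [b [tb tNb]] := imbalance_rcons tk.
have sub : unbalanced_stretch t N.+1 `<=`
    unbalanced_stretch (rcons t b) N `|` unbalanced_stretch (rcons t (~~ b)) N.
  move=> X [tX XN].
  have h c : X (size t) = c -> unbalanced_stretch (rcons t c) N X.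
    move=> Xc; split; first exact/cylinder_rcons.
    by move=> n /=; rewrite size_rcons => nN; apply: XN; lia.
  have [/h|Xb] := eqVneq (X (size t)) b; first by left.
  by right; apply: h; apply/esym/addbP; rewrite addbC -negb_eqb.
apply: le_trans (_ : _ <= fair_coin (unbalanced_stretch (rcons t b) N) +
  fair_coin (unbalanced_stretch (rcons t (~~ b)) N))%E _.
  apply: le_trans (measureU2 _ _ _); try exact: measurable_unbalanced_stretch.
  by apply: le_measure sub; rewrite inE; try apply: measurableU;
    exact: measurable_unbalanced_stretch.
(* Both extensions have length |t| + 1; whichever digit b is, their distances
are k and k + 2, and the two halves of 2^-|t| give the mean in survival. *)
apply: le_trans (leeD (IH _) (IH _)) _; rewrite -EFinD lee_fin !size_rcons tb tNb.
rewrite /= exprS invfM; lra.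
Qed.

Definition never_balanced_after (t : seq bool) : set borel_cantor :=
  cylinder t `&`
    [set X | forall n, (size t <= n)%N -> trace X n \notin half_sets n].

Lemma measurable_never_balanced_after t : measurable (never_balanced_after t).
Proof.
rewrite (_ : never_balanced_after t = \bigcap_N unbalanced_stretch t N).
  by apply: bigcapT_measurable => N; exact: measurable_unbalanced_stretch.
apply/seteqP; split=> [X [tX XN] N _|X XN].
  by split=> // n /andP[+ _]; exact: XN.
split=> [|n nt]; first by have [] := XN 0%N I.
by have [_] := XN n I; apply; rewrite nt leq_addl.
Qed.

Lemma fair_coin_never_balanced_after t :
  (@fair_coin R (never_balanced_after t) = 0)%E.
Proof.
have m := measurable_never_balanced_after t.
have stretch N : (fair_coin (never_balanced_after t) <=
    (2 ^- size t * survival N (imbalance t) : R)%:E)%E.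
  apply: le_trans (fair_coin_unbalanced_stretch t N).
  apply: le_measure; rewrite ?inE //; first exact: measurable_unbalanced_stretch.
  by move=> X [tX XN]; split=> // n /andP[+ _]; exact: XN.
rewrite -[LHS](fineK (fin_num_measure _ _ m)); congr EFin.
apply/eqP; rewrite eq_le fine_ge0 // andbT.
have cvg0 : (fun N => 2 ^- size t * survival N (imbalance t)) @ \oo --> (0 : R).
  by rewrite -[0](mulr0 (2 ^- size t)); apply: cvgMl_tmp; exact: survival_cvg0.
apply: (cvgr_to_ge cvg0); near=> N.
by rewrite -lee_fin fineK //; exact: fin_num_measure.
Unshelve. all: by end_near. Qed.

(** If the walk of X stops visiting 0 from time m on, the prefix of X of length
m serves as t. Indexing by finite sequences instead of by m makes every member
of the union an event conditioned on a known position of the walk. *)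
Lemma not_guessed_never_balanced :
  ~` guessed_reals half_sets = \bigcup_t never_balanced_after t.
Proof.
apply/seteqP; split=> X.
  move=> /infinite_natP /existsNP[m Xm]; exists (mkseq X m) => //.
  split; first exact/cylinderE.
  move=> n /=; rewrite size_mkseq => mn; apply/negP => Xn.
  by apply: Xm; exists n.
move=> [t _ [_ Xt]] /infinite_natP /(_ (size t))[n tn].
by rewrite /= (negPf (Xt n tn)).
Qed.

Lemma fair_coin_guessed_half_sets : (@fair_coin R (guessed_reals half_sets) = 1)%E.
Proof.
have mG := measurable_guessed_reals half_sets.
have : (@fair_coin R).-negligible (~` guessed_reals half_sets).
  rewrite not_guessed_never_balanced.
  (* The finite sequences are enumerated by nat; codes of none of them give
     the empty set. *)
  pose F n := if unpickle n is Some t then never_balanced_after t else set0.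
  apply: (@negligibleS _ _ _ _ (\bigcup_n F n)).
    by move=> X [t _ Xt]; exists (pickle t) => //; rewrite /F pickleK.
  apply: negligible_bigcup => n; rewrite /F.
  case: unpickle => [t|]; last exact: negligible_set0.
  apply/negligibleP; first exact: measurable_never_balanced_after.
  exact: fair_coin_never_balanced_after.
move=> /(measure_negligible (measurableC mG)) G0.
rewrite -[guessed_reals _]setCK (probability_setC _ (measurableC mG)).
by rewrite [X in (_ - X)%E](G0 : _ = 0%E) sube0.
Qed.

End measure.

Lemma card_half_sets n : ~~ odd n -> #|half_sets n| = 'C(n, n./2).
Proof.
move=> en; have := card_draws 'I_n n./2; rewrite card_ord => <-.
by apply: eq_card => X; rewrite half_setsE inE -[RHS](inj_eq double_inj) even_halfK.
Qed.

Theorem corollary4p7 (R : realType) :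
  (forall n : nat, ~~ odd n -> #|half_sets n| = 'C(n, n./2)) /\
  @fair_coin R (guessed_reals half_sets) = 1%E.
Proof. by split; [exact: card_half_sets|exact: fair_coin_guessed_half_sets]. Qed.
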